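(* Let $C\subset\mathbb R^3$ be a closed strictly convex cone with vertex at the origin. If $C$ is not a set of measure zero, if $C$ has connected exterior, and if $C\subseteq C_\gamma\setminus\operatorname{int}C_{\vartheta_0}$ for some $\gamma\in(\vartheta_0,\pi/2)$, then $C$ is an admissible source cone.
   Context: For $\gamma\in(0,\pi/2)$, $C_\gamma=\{x\in\mathbb R^3:\ |x'|\le x_3\tan\gamma\}$, $x'=(x_1,x_2)$, is the closed strictly convex circular cone of half-angle $\gamma$. The magic angle $\vartheta_0\in(0,\pi/2)$ is defined by $\cos\vartheta_0=1/\sqrt3$. A cone is strictly convex if it is convex and contains no full line. **Admissible source cone.** A closed cone $C\subset\mathbb R^3$ with vertex at the origin which is contained in some closed strictly convex circular cone (half-opening angle $<\pi/2$), whose exterior is connected, and for which $\int_{\mathbb S^2\cap C}Y_2^m\,dS\ne0$ for some $m\in\{-2,-1,0,1,2\}$. Here, in spherical coordinates $x=(\sin\vartheta\cos\varphi,\sin\vartheta\sin\varphi,\cos\vartheta)$, $$Y_N^m(\varphi,\vartheta)=(-1)^m\sqrt{\tfrac{2N+1}{4\pi}\tfrac{(N-m)!}{(N+m)!}}\;e^{im\varphi}P_N^m(\cos\vartheta),$$ where, with $P_N$ the Legendre polynomials, $P_N^m(x)=(-1)^m(1-x^2)^{m/2}\partial_x^mP_N(x)$ and $P_N^{-m}=(-1)^m\frac{(N-m)!}{(N+m)!}P_N^m$ for $m=0,\dots,N$. *)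

(* Defs.v *)
From mathcomp Require Import all_boot all_order all_algebra.
From mathcomp Require Import all_classical all_reals all_analysis.
From mathcomp Require Import complex.

Set Implicit Arguments.
Unset Strict Implicit.
Unset Printing Implicit Defensive.

Import Order.TTheory GRing.Theory Num.Theory.
Import numFieldNormedType.Exports.

Local Open Scope classical_set_scope.
Local Open Scope ring_scope.
Local Open Scope complex_scope.

(* R^3 is R * R * R, whose product structures in the library are the usual
   vector space, topology and Borel sigma-algebra; x' is (x.1.1, x.1.2) and
   x_3 is x.2. *)
Section Geometry.
Variable R : realType.
Local Notation R3 := (R * R * R)%type.
Implicit Types (x a : R3) (A C : set R3).

Definition dot x a : R := x.1.1 * a.1.1 + x.1.2 * a.1.2 + x.2 * a.2.

Definition enorm x : R := Num.sqrt (dot x x).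

(* For a unit vector [a] and 0 < g < pi / 2: the circular cone with vertex 0,
   axis [a] and half-opening angle [g]; it compares the components of [x]
   orthogonal to and along [a]. *)
Definition circular_cone a (g : R) : set R3 :=
  [set x | enorm (x - dot x a *: a) <= dot x a * tan g].

Definition std_cone (g : R) : set R3 :=
  [set x | Num.sqrt (x.1.1 ^+ 2 + x.1.2 ^+ 2) <= x.2 * tan g].

Lemma std_coneE (g : R) : std_cone g = circular_cone (0, 0, 1) g.
Proof.
have dotE (x y z : R) : dot (x, y, z) (0, 0, 1) = z.
  by rewrite /dot /= !mulr0 mulr1 !add0r.
have perpE (x y z : R) : enorm ((x, y, z) - dot (x, y, z) (0, 0, 1) *: (0, 0, 1))
    = Num.sqrt (x ^+ 2 + y ^+ 2).
  rewrite dotE /enorm /dot [((x, y, z) - _).1.1](_ : _ = x - z * 0) //.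
  rewrite [((x, y, z) - _).1.2](_ : _ = y - z * 0) //.
  rewrite [((x, y, z) - _).2](_ : _ = z - z * 1) //.
  by rewrite mulr0 mulr1 !subr0 subrr mulr0 addr0 -!expr2.
apply/seteqP; split => -[[x y] z]; rewrite /std_cone /circular_cone /=;
  by rewrite perpE dotE.
Qed.

Definition closed_cone C : Prop :=
  closed C /\ forall (t : R) x, 0 <= t -> C x -> C (t *: x).

Definition contains_line C : Prop :=
  exists p v : R3, v != 0 /\ forall t : R, C (p + t *: v).

Definition strictly_convex C : Prop := convex_set C /\ ~ contains_line C.

Definition exterior C : set R3 := (~` C)^°.

Definition lebesgue3 : set R3 -> \bar R :=
  ((lebesgue_measure \x lebesgue_measure) \x lebesgue_measure)%E.

Definition sphere : set R3 := [set x | enorm x = 1].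

Definition spherical (phi theta : R) : R3 :=
  (sin theta * cos phi, sin theta * sin phi, cos theta).

Definition cintegral d (T : measurableType d) (mu : {measure set T -> \bar R})
    (D : set T) (f : T -> R[i]) : R[i] :=
  (\int[mu]_(u in D) complex.Re (f u)) +i* (\int[mu]_(u in D) complex.Im (f u)).

(* Surface integral over [A], a subset of the sphere, of a function given in
   spherical coordinates: dS = sin theta dphi dtheta. *)
Definition sphere_integral A (f : R -> R -> R[i]) : R[i] :=
  cintegral (lebesgue_measure \x lebesgue_measure)%E
    [set u : R * R | [/\ 0 <= u.1 < 2 * pi, 0 <= u.2 <= pi
                       & A (spherical u.1 u.2)]]
    (fun u => f u.1 u.2 * (sin u.2)%:C).

End Geometry.

Arguments lebesgue3 {R}.
Arguments sphere {R}.

Section Harmonics.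
Variable R : realType.

(* Rodrigues' formula *)
Definition legendre (N : nat) : {poly R} :=
  (2 ^+ N * N`!%:R)^-1 *: (('X^2 - 1) ^+ N)^`(N).

(* (1 - x^2)^(m/2) is rendered by the m-th power of the square root, for
   x in [-1, 1]. *)
Definition assoc_legendre_nat (N m : nat) (x : R) : R :=
  (-1) ^+ m * Num.sqrt (1 - x ^+ 2) ^+ m * ((legendre N)^`(m)).[x].

(* Negz k is the integer -(k + 1). *)
Definition assoc_legendre (N : nat) (m : int) (x : R) : R :=
  match m with
  | Posz k => assoc_legendre_nat N k x
  | Negz k => (-1) ^+ k.+1 * ((N - k.+1)`!%:R / (N + k.+1)`!%:R)
              * assoc_legendre_nat N k.+1 x
  end.

Definition expi (t : R) : R[i] := cos t +i* sin t.

(* For |m| <= N the integers N - m and N + m are nonnegative, so that their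
   absolute values below are the natural numbers N - m and N + m. *)
Definition sph_harm (N : nat) (m : int) (phi theta : R) : R[i] :=
  ((-1) ^ m * Num.sqrt ((2 * N%:R + 1) / (4 * pi)
     * ((absz (N%:Z - m))`!%:R / (absz (N%:Z + m))`!%:R)))%:C
  * expi (m%:~R * phi)
  * (assoc_legendre N m (cos theta))%:C.

End Harmonics.

Definition admissible_source_cone (R : realType) (C : set (R * R * R)) : Prop :=
  [/\ closed_cone C,
      exists (a : R * R * R) (g : R),
        [/\ enorm a = 1, 0 < g < pi / 2 & C `<=` circular_cone a g],
      connected (exterior C)
    & exists m : int, -2 <= m <= 2 /\
        sphere_integral (sphere `&` C) (sph_harm 2 m) != 0].

(* Main.v *)
Require Import Defs.
From mathcomp Require Import all_boot all_order all_algebra.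
From mathcomp Require Import all_classical all_reals all_analysis.
From mathcomp Require Import complex measurable_realfun.
From mathcomp Require Import ring lra.

(** Only the zonal harmonic is needed: up to a positive factor, [Y_2^0] is
    [3 cos^2 theta - 1], which vanishes exactly at the magic angle. A direction
    lying in the half-space [x_3 >= 0] but outside the interior of the magic
    cone has [0 <= cos theta <= 1 / sqrt 3] ([magic_angle_cos]), so the
    integrand of [Y_2^0] has constant sign on the directions of [C], and its
    integral can vanish only if it is zero almost everywhere
    ([Rintegral_le0_neq0]).

    To exclude the latter, no change of variables between volume and spherical
    coordinates is used; convexity replaces it. A set that is not negligible
    lies in no plane through the origin, planes being negligible by Fubini
    ([plane_null]), so [C] contains three linearly independent vectors
    ([nonnull_det3]). Being a convex cone, [C] contains the open cone of their
    positive combinations. In the coordinates [(phi, theta)] this open set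
    gives a nonempty open rectangle of directions of [C] ([convex_cone_box]).
    Moreover [cos] is strictly decreasing in [theta] and every point of the
    rectangle has a point of smaller [theta] in the rectangle, where
    [3 cos^2 theta <= 1] holds too. Hence the integrand is strictly negative on
    the whole rectangle, a set of positive measure. *)

Set Implicit Arguments.
Unset Strict Implicit.
Unset Printing Implicit Defensive.

Import Order.TTheory GRing.Theory Num.Theory.
Import numFieldNormedType.Exports.

Local Open Scope classical_set_scope.
Local Open Scope ring_scope.

(** * Null sets and integrals *)

Lemma product_null_sections d1 d2 (T1 : measurableType d1)
    (T2 : measurableType d2) (R : realType) (m1 : {measure set T1 -> \bar R})
    (m2 : {sigma_finite_measure set T2 -> \bar R}) (A : set (T1 * T2))
    (N : set T1) :
  measurable A -> m1.-negligible N ->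
  (forall x, ~ N x -> m2 (xsection A x) = 0%E) ->
  (m1 \x m2)%E A = 0%E.
Proof.
move=> mA nN A0; rewrite /product_measure1.
rewrite (@ge0_ae_eq_integral _ _ _ m1 setT (m2 \o xsection A) (cst 0%E)) //.
- exact: integral0.
- exact: measurable_fun_xsection.
- apply: negligibleS nN => x /= h; apply: contrapT => Nx; apply: h => _.
  exact: A0.
Qed.

(** The inductive step showing that hyperplanes are null: if [c != 0] the
    sections are points, and if [c = 0] the set is a cylinder over the zeros
    of [f]. *)
Lemma linear_zeros_null d (T : measurableType d) (R : realType)
    (m : {measure set T -> \bar R}) (f : T -> R) (c : R) :
  measurable_fun setT f -> (c = 0 -> m.-negligible [set t | f t = 0]) ->
  (m \x lebesgue_measure)%E.-negligible [set p | f p.1 + c * p.2 = 0].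
Proof.
move=> mf f0.
have mA : measurable [set p : T * R | f p.1 + c * p.2 = 0].
  rewrite -[X in measurable X]setTI.
  have : measurable_fun setT (fun p : T * R => f p.1 + c * p.2).
    apply: measurable_funD; first exact: measurableT_comp.
    by apply: measurable_funM => //; exact: measurable_snd.
  by move=> /(_ measurableT [set 0] (measurable_set1 0)).
exists [set p | f p.1 + c * p.2 = 0]; split => //.
have [c0|c0] := eqVneq c 0.
  apply: (product_null_sections (m2 := lebesgue_measure) mA (f0 c0)) => t /= ft.
  rewrite [xsection _ _](_ : _ = set0) ?measure0//.
  apply/seteqP; split => z //; rewrite /xsection/= inE/= c0.
  by rewrite (mul0r (z : R)) addr0.
apply: (product_null_sections (N := set0)) => //.
  exact: negligible_set0.
move=> t _; apply/eqP; rewrite -measure_le0.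
rewrite -(lebesgue_measure_set1 (- f t / c)) le_measure ?inE//.
  exact: measurable_xsection.
have solve_z (z : R) : f t + c * z = 0 -> z = - f t / c.
  by move=> h; apply: (mulIf c0); rewrite divfK//; lra.
by move=> z; rewrite /xsection/= inE => /solve_z.
Qed.

(** The measurable sets of [R * R] are generated by measurable rectangles, not
    by open sets; an open set is nevertheless a countable union of rectangles
    with rational endpoints. *)
Lemma open_measurable_plane (R : realType) (U : set (R * R)) :
  open U -> measurable U.
Proof.
move=> oU.
pose box (q : (rat * rat) * (rat * rat)) : set (R * R) :=
  `]ratr q.1.1, ratr q.1.2[%classic `*` `]ratr q.2.1, ratr q.2.2[%classic.
rewrite [U](_ : _ = \bigcup_(q in [set q | box q `<=` U]) box q).
  rewrite bigcup_mkcond; apply: countable_bigcupT_measurable => // q.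
  by case: ifP => // _; apply: measurableX; exact: measurable_itv.
apply/seteqP; split => [[x y] Uxy|p [q /= qU]]; last exact: qU.
have [[A B] /= [nA nB] ABU] : nbhs (x, y) U by exact: open_nbhs_nbhs.
have [e /= e0 eA] := nA; have [f /= f0 fB] := nB.
have rat_around (z r : R) : 0 < r ->
    exists q : rat * rat, z \in `]ratr q.1, ratr q.2[%R /\
      forall w, w \in `]ratr q.1, ratr q.2[%R -> `|z - w| < r.
  move=> r0.
  have /rat_in_itvoo[q1] : z - r < z by rewrite ltrBlDr ltrDl.
  have /rat_in_itvoo[q2] : z < z + r by rewrite ltrDl.
  rewrite !in_itv/= => /andP[zq2 q2r] /andP[rq1 q1z].
  exists (q1, q2); rewrite /= !in_itv/= q1z zq2; split => // w.
  rewrite in_itv/= => /andP[q1w wq2].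
  rewrite ltr_norml; apply/andP; split; lra.
have [p [xp pA]] := rat_around x e e0.
have [q [yq qB]] := rat_around y f f0.
exists (p, q) => //=.
by move=> [x' y'] [/= /pA /eA Ax' /qB /fB By']; exact: ABU.
Qed.

(** If the integral of a nonpositive function is zero, so is that of its
    absolute value, and the function is zero almost everywhere. *)
Lemma Rintegral_le0_neq0 d (T : measurableType d) (R : realType)
    (mu : {measure set T -> \bar R}) (D B : set T) (f : T -> R) :
  measurable D -> mu.-integrable D (EFin \o f) ->
  (forall x, D x -> f x <= 0) -> (forall x, B x -> D x /\ f x < 0) ->
  ~ mu.-negligible B -> \int[mu]_(x in D) f x != 0.
Proof.
move=> mD intf f_le0 fB nB; apply/negP => /eqP int0; apply: nB.
have mf : measurable_fun D (EFin \o f) := measurable_int mu intf.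
have intN0 : (\int[mu]_(x in D) `|(f x)%:E| = 0)%E.
  rewrite (eq_integral (fun x => - (f x)%:E)%E); last first.
    by move=> x /set_mem Dx; rewrite lee0_abs// lee_fin f_le0.
  rewrite integralN; last exact: integrable_add_def.
  rewrite -[X in (- X)%E]fineK; last exact: integrable_fin_num.
  by move: int0; rewrite /Rintegral => ->; rewrite oppe0.
have := (ae_eq_integral_abs mu mD mf).1 intN0.
apply: negligibleS => x /fB[Dx fx0] /= /(_ Dx) [].
by move=> fx; rewrite fx ltxx in fx0.
Qed.

Section LebesguePlane.
Variable R : realType.
Local Notation lebesgue2 := (@lebesgue_measure R \x @lebesgue_measure R)%E.

Lemma lebesgue2_itvX (i j : interval R) :
  lebesgue2 ([set` i] `*` [set` j]) =
  (lebesgue_measure [set` i] * lebesgue_measure [set` j])%E.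
Proof. by apply: product_measure1E; exact: measurable_itv. Qed.

Lemma box_nonnull (a b c d : R) : a < b -> c < d ->
  ~ lebesgue2.-negligible (`]a, b[ `*` `]c, d[).
Proof.
move=> ab cd nB.
have mB : measurable (`]a, b[%classic `*` `]c, d[%classic : set (R * R)).
  by apply: measurableX; exact: measurable_itv.
have : lebesgue2 (`]a, b[ `*` `]c, d[) = 0%E by exact: measure_negligible.
rewrite lebesgue2_itvX.
rewrite !lebesgue_measure_itv /= ?lte_fin ab cd -!EFinB -EFinM => -[] /eqP.
by rewrite mulf_eq0 !subr_eq0 !gt_eqF.
Qed.

Lemma zonal_integrable (g : R -> R) (D : set (R * R)) :
  continuous g -> (exists M, forall x, `|g x| <= M) ->
  measurable D -> (lebesgue2 D < +oo)%E ->
  lebesgue2.-integrable D (EFin \o (g \o snd)).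
Proof.
move=> cg [M gM] mD Dfin; apply: measurable_bounded_integrable => //.
  apply: measurable_funTS; apply: measurableT_comp => //.
  exact: continuous_measurable_fun.
exists M; split; rewrite ?num_real// => x Mx y _ /=.
by rewrite (le_trans _ (ltW Mx)).
Qed.

Lemma open_pair_box (U : set (R * R)) (p : R * R) : open U -> U p ->
  exists2 e : R, 0 < e &
    forall x y : R, `|p.1 - x| < e -> `|p.2 - y| < e -> U (x, y).
Proof.
move=> oU Up; have [[A B] /= [nA nB] ABU] : nbhs p U by exact: open_nbhs_nbhs.
have [e /= e0 eA] := nA; have [f /= f0 fB] := nB.
exists (Num.min e f); first by rewrite lt_min e0.
move=> x y; rewrite !lt_min => /andP[xe _] /andP[_ yf].
by apply: ABU; split; [exact: eA|exact: fB].
Qed.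

End LebesguePlane.

(** * Three independent vectors in a nonnull set *)

Section Cones.
Variable R : realType.
Local Notation R3 := (R * R * R)%type.
Local Notation lebesgue2 := (@lebesgue_measure R \x @lebesgue_measure R)%E.

Definition cross (u v : R3) : R3 :=
  (u.1.2 * v.2 - u.2 * v.1.2, u.2 * v.1.1 - u.1.1 * v.2,
   u.1.1 * v.1.2 - u.1.2 * v.1.1).

Definition det3 (u v w : R3) : R := dot u (cross v w).

Lemma det3_cycle (u v w : R3) : det3 u v w = det3 w u v.
Proof. by rewrite /det3 /dot /cross /=; ring. Qed.

(** Cramer's rule: when [u], [v], [w] are independent, the coordinates of [x]
    in this basis are, up to the factor [det3 u v w], scalar products of [x]
    with the cross products of the basis vectors. *)
Lemma cramer3 (x u v w : R3) :
  det3 u v w *: x = det3 x v w *: u + det3 x w u *: v + det3 x u v *: w.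
Proof.
case: x u v w => [[x1 x2] x3] [[u1 u2] u3] [[v1 v2] v3] [[w1 w2] w3].
by congr (_, _, _); rewrite /det3 /dot /cross /= /GRing.scale /=; ring.
Qed.

Lemma vec3_eq0 (x : R3) :
  (x == 0) = [&& x.1.1 == 0, x.1.2 == 0 & x.2 == 0].
Proof. by case: x => [[a b] c]; rewrite -!pair_eqE /= /pair_eq /= andbA. Qed.

Lemma plane_null (n : R3) :
  n != 0 -> lebesgue3.-negligible [set p | dot p n = 0].
Proof.
case: n => [[a b] c] n0.
rewrite (_ : [set p | _] = [set p | (a * p.1.1 + b * p.1.2) + c * p.2 = 0]);
  last first.
  apply/seteqP; split => -[[x y] z];
  by rewrite /dot /= (mulrC x) (mulrC y) (mulrC z).
have mab : measurable_fun setT (fun p : R * R => a * p.1 + b * p.2).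
  by apply: measurable_funD; exact: measurable_funM.
apply: (@linear_zeros_null _ _ R (lebesgue_measure \x lebesgue_measure)%E
  _ _ mab) => c0.
have ma : measurable_fun setT ( *%R a) by [].
apply: (@linear_zeros_null _ _ R lebesgue_measure _ _ ma) => b0.
rewrite [X in _.-negligible X](_ : _ = [set 0]); last first.
  apply/seteqP; split => [t /= /eqP|_ ->]; last by rewrite /= mulr0.
  rewrite mulf_eq0 => /orP[/eqP a0|/eqP//].
  by move: n0; rewrite a0 b0 c0 eqxx.
by exists [set 0]; split => //; exact: lebesgue_measure_set1.
Qed.

(** If no three vectors of [C] were independent, [C] would lie in a plane
    through 0, whose normal vector is a nonzero cross product of two elements
    of [C] if there is one; otherwise all elements of [C] lie on one line
    through 0, and any plane containing that line will do. *)
Lemma nonnull_det3 (C : set R3) : ~ lebesgue3.-negligible C ->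
  exists u v w, [/\ C u, C v, C w & det3 u v w != 0].
Proof.
move=> nC; apply: contrapT => indep; apply: nC.
have det0 u v w : C u -> C v -> C w -> det3 u v w = 0.
  move=> Cu Cv Cw; apply: contrapT => /eqP uvw.
  by apply: indep; exists u, v, w.
suff [n n0 Cn] : exists2 n, n != 0 & C `<=` [set p | dot p n = 0].
  have [N [mN N0 nN]] := plane_null n0.
  by exists N; split => //; exact: subset_trans Cn nN.
have [[u [v [Cu Cv uv]]]|par] := pselect (exists u v,
  [/\ C u, C v & cross u v != 0]).
  by exists (cross u v) => // w Cw; exact: det0.
have {}par u v : C u -> C v -> cross u v = 0.
  by move=> Cu Cv; apply: contrapT => /eqP uv; apply: par; exists u, v.
have [[u Cu u0]|C0] := pselect (exists2 u, C u & u != 0); last first.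
  exists (0, 0, 1); first by rewrite vec3_eq0 /= oner_eq0 !andbF.
  move=> p Cp /=; have [->|p0] := eqVneq p 0.
    by rewrite /dot/= !mul0r !addr0.
  by case: C0; exists p.
(* The normal [cross e u] works for every [e] not parallel to [u]. *)
suff [e eu] : exists e, cross e u != 0.
  exists (cross e u) => // w Cw; rewrite /= -/(det3 w e u) -det3_cycle.
  by rewrite /det3 par// /dot /= !mulr0 !addr0.
have [u1|u1] := eqVneq u.1.1 0; last first.
  by exists (0, 1, 0); rewrite vec3_eq0 /cross /= !mul0r !mul1r !sub0r !oppr_eq0
   (negbTE u1) !andbF.
exists (1, 0, 0); apply: contra u0; rewrite !vec3_eq0 u1 /cross /=.
by rewrite !mul0r !mul1r !subr0 sub0r oppr_eq0 !eqxx /= andbC.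
Qed.

(** The sum is twice the midpoint. *)
Lemma cone_addr (C : set R3) x y :
  closed_cone C -> convex_set C -> C x -> C y -> C (x + y).
Proof.
move=> [_ scaleC] convC Cx Cy.
have h0 : 0 <= 1 / 2 :> R by lra.
have h1 : 1 / 2 <= 1 :> R by lra.
pose l : {i01 R} := Itv01 h0 h1.
have := convC x y l (mem_set Cx) (mem_set Cy).
rewrite inE /conv /= => /(scaleC 2 _ (ler0n R 2)); congr C.
rewrite scalerDr !scalerA mulrC divfK ?pnatr_eq0// scale1r /unstable.onem.
by rewrite (_ : 2 * (1 - 1 / 2) = 1) ?scale1r//; field.
Qed.

Lemma cone_comb (C : set R3) (a b c : R) u v w :
  closed_cone C -> convex_set C -> C u -> C v -> C w ->
  0 <= a -> 0 <= b -> 0 <= c -> C (a *: u + b *: v + c *: w).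
Proof.
move=> coneC convC Cu Cv Cw a0 b0 c0; have [_ scaleC] := coneC.
by do 2?[apply: cone_addr => //]; exact: scaleC.
Qed.

(** * Spherical coordinates *)

Lemma circle_upper (a b : R) : a ^+ 2 + b ^+ 2 = 1 -> 0 < b ->
  exists t, [/\ 0 < t < pi, cos t = a & sin t = b].
Proof.
move=> ab b0.
have a1 : -1 <= a <= 1 by nra.
have sb : sin (acos a) = b.
  rewrite sin_acos// (_ : 1 - a ^+ 2 = b ^+ 2); last by rewrite -ab; ring.
  by rewrite sqrtr_sqr gtr0_norm.
exists (acos a); split => //; last by rewrite acosK.
apply/andP; split.
  rewrite lt_neqAle acos_ge0// andbT eq_sym.
  by apply: contraTneq b0 => t0; rewrite -sb t0 sin0 ltxx.
rewrite lt_neqAle acos_lepi// andbT.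
by apply: contraTneq b0 => t0; rewrite -sb t0 sinpi ltxx.
Qed.

Lemma circle_coord (a b : R) : a ^+ 2 + b ^+ 2 = 1 -> b != 0 ->
  exists t, [/\ 0 < t < 2 * pi, cos t = a & sin t = b].
Proof.
move=> ab; have pi0 := pi_gt0 R.
rewrite neq_lt => /orP[b0|b0].
  have [||t [t0 ct st]] := @circle_upper a (- b); rewrite ?sqrrN ?oppr_gt0//.
  exists (2 * pi - t); split; first by lra.
    by rewrite mulr_natl cosB cos2pi sin2pi mul1r mul0r addr0.
  by rewrite mulr_natl sinB cos2pi sin2pi mul1r mul0r sub0r st opprK.
have [t [t0 ct st]] := circle_upper ab b0.
by exists t; split => //; lra.
Qed.

(** Requiring [x_2 != 0] keeps [p] away from the half-plane [phi = 0] and from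
    the axis, so that both angles can be taken in open intervals. *)
Lemma spherical_coord (p : R3) : p.1.2 != 0 ->
  exists r phi theta, [/\ 0 < r, 0 < phi < 2 * pi, 0 < theta < pi
    & p = r *: spherical phi theta].
Proof.
case: p => [[x y] z] /= y0.
have y2 : 0 < y ^+ 2 by rewrite exprn_even_gt0.
have x2 := sqr_ge0 x; have z2 := sqr_ge0 z.
pose rho := Num.sqrt (x ^+ 2 + y ^+ 2).
pose r := Num.sqrt (x ^+ 2 + y ^+ 2 + z ^+ 2).
have rho0 : 0 < rho by rewrite sqrtr_gt0; lra.
have r0 : 0 < r by rewrite sqrtr_gt0; lra.
have rhoE : rho ^+ 2 = x ^+ 2 + y ^+ 2 by rewrite sqr_sqrtr//; lra.
have rE : r ^+ 2 = rho ^+ 2 + z ^+ 2 by rewrite rhoE sqr_sqrtr//; lra.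
have rhoN0 := lt0r_neq0 rho0; have rN0 := lt0r_neq0 r0.
have [||phi [phi_itv cphi sphi]] := @circle_coord (x / rho) (y / rho).
- by rewrite !expr_div_n -mulrDl -rhoE divff// expf_neq0.
- by rewrite mulf_neq0// invr_neq0.
have [||theta [theta_itv ctheta stheta]] := @circle_upper (z / r) (rho / r).
- by rewrite !expr_div_n -mulrDl addrC -rE divff// expf_neq0.
- by rewrite divr_gt0.
exists r, phi, theta; split => //.
rewrite /spherical cphi sphi ctheta stheta.
congr (_, _, _); rewrite /= /GRing.scale/=; by field; rewrite ?rN0 ?rhoN0.
Qed.

Lemma enorm_spherical (phi theta : R) : enorm (spherical phi theta) = 1.
Proof.
rewrite /enorm /dot /= -!expr2 !exprMn -mulrDr cos2Dsin2 mulr1 addrC.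
by rewrite cos2Dsin2 sqrtr1.
Qed.

Lemma spherical_continuous :
  continuous (fun p : R * R => spherical p.1 p.2).
Proof.
move=> p; rewrite /spherical.
have csin1 : (fun p : R * R => sin p.1) @ p --> sin p.1.
  by apply: continuous_comp; [exact: cvg_fst|exact: continuous_sin].
have csin2 : (fun p : R * R => sin p.2) @ p --> sin p.2.
  by apply: continuous_comp; [exact: cvg_snd|exact: continuous_sin].
have ccos1 : (fun p : R * R => cos p.1) @ p --> cos p.1.
  by apply: continuous_comp; [exact: cvg_fst|exact: continuous_cos].
have ccos2 : (fun p : R * R => cos p.2) @ p --> cos p.2.
  by apply: continuous_comp; [exact: cvg_snd|exact: continuous_cos].
exact: (cvg_pair (cvg_pair (cvgM csin2 ccos1) (cvgM csin2 csin1)) ccos2).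
Qed.

Lemma dot_continuous (n : R3) : continuous (fun x : R3 => dot x n).
Proof.
move=> x; rewrite /dot.
apply: cvgD; first apply: cvgD.
all: apply: cvgM; [|exact: cvg_cst].
- apply: (@continuous_comp _ _ _ fst fst); exact: cvg_fst.
- apply: (@continuous_comp _ _ _ fst snd); [exact: cvg_fst|exact: cvg_snd].
- exact: cvg_snd.
Qed.

(** Provides a point of the open cone spanned by [u], [v], [w] to which
    [spherical_coord] applies: [y] is a nonzero linear form on the space, so
    it cannot vanish at all positive combinations. *)
Lemma positive_comb_y (u v w : R3) : det3 u v w != 0 ->
  exists s t : R, [/\ 0 < s, 0 < t & (u + s *: v + t *: w).1.2 != 0].
Proof.
move=> uvw; apply: contrapT => none.
have y0 (s t : R) : 0 < s -> 0 < t -> u.1.2 + s * v.1.2 + t * w.1.2 = 0.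
  move=> s0 t0; apply/eqP; apply: contrapT => /negP st.
  by apply: none; exists s, t.
have two0 : 0 < 2 :> R by lra.
(* Three values of an affine function determine its coefficients. *)
have h11 := y0 1 1 ltr01 ltr01.
have h12 := y0 1 2 ltr01 two0.
have h21 := y0 2 1 two0 ltr01.
have u2 : u.1.2 = 0 by lra.
have v2 : v.1.2 = 0 by lra.
have w2 : w.1.2 = 0 by lra.
by move/eqP: uvw; apply; rewrite /det3 /dot /cross /= u2 v2 w2; ring.
Qed.

(** The directions whose three coordinates in a basis contained in [C] are
    positive form an open set of angles, and they all belong to [C]. *)
Lemma convex_cone_box (C : set R3) :
  closed_cone C -> convex_set C -> ~ lebesgue3.-negligible C ->
  exists a b c d : R, [/\ a < b, c < d & forall phi theta : R,
    a < phi < b -> c < theta < d ->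
    [/\ 0 < phi < 2 * pi, 0 < theta < pi & C (spherical phi theta)]].
Proof.
move=> coneC convC nC.
have [u [v [w [Cu Cv Cw]]]] := nonnull_det3 nC.
set D := det3 u v w => D0.
have [s [t [s0 t0 q0]]] := positive_comb_y D0.
have [r [phi0 [theta0 [r0 phi0_itv theta0_itv qE]]]] := spherical_coord q0.
set q := u + _ + _ in q0 qE.
pose coord (n : R3) (p : R * R) := dot (spherical p.1 p.2) n / D.
have coord_open n : open [set p | 0 < coord n p].
  apply: (@open_comp _ _ (coord n) [set x | 0 < x]); last exact: open_gt.
  move=> p _; apply: cvgM; last exact: cvg_cst.
  apply: (@continuous_comp _ _ _ (fun p => spherical p.1 p.2)
    (fun x : R3 => dot x n)).
    exact: spherical_continuous.
  exact: dot_continuous.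
pose U : set (R * R) := (fst @^-1` `]0, 2 * pi[ `&` snd @^-1` `]0, pi[) `&`
  ([set p | 0 < coord (cross v w) p] `&` ([set p | 0 < coord (cross w u) p]
    `&` [set p | 0 < coord (cross u v) p])).
have oU : open U.
  apply: openI; last by do 2?[apply: openI].
  apply: openI; apply: open_comp; try exact: interval_open.
    by move=> p _; exact: cvg_fst.
  by move=> p _; exact: cvg_snd.
(* Positivity of a coordinate only depends on the direction, so it can be
   checked at [q]. *)
have coord_q n (a : R) : 0 < a -> dot q n = a * D -> 0 < coord n (phi0, theta0).
  move=> a0 qn; rewrite /coord /=.
  have -> : dot (spherical phi0 theta0) n = a * D / r.
    rewrite -qn qE /dot /= /GRing.scale /=; field.
    exact: lt0r_neq0.
  have -> : a * D / r / D = a / r by field; rewrite D0 lt0r_neq0.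
  exact: divr_gt0.
have Up : U (phi0, theta0).
  split; first by split; rewrite /= in_itv.
  split; [|split].
  - apply: (coord_q _ 1) => //.
    by rewrite /D /q /det3 /dot /cross /= /GRing.scale /=; ring.
  - apply: (coord_q _ s) => //.
    by rewrite /D /q /det3 /dot /cross /= /GRing.scale /=; ring.
  - apply: (coord_q _ t) => //.
    by rewrite /D /q /det3 /dot /cross /= /GRing.scale /=; ring.
have [e e0 box] := open_pair_box oU Up.
exists (phi0 - e), (phi0 + e), (theta0 - e), (theta0 + e).
split; [lra|lra|move=> phi theta phi_e theta_e].
have [||[/= phi_itv theta_itv] [/= /ltW p1 [/= /ltW p2 /= /ltW p3]]] :=
  box phi theta.
- by rewrite /= ltr_norml; apply/andP; split; lra.
- by rewrite /= ltr_norml; apply/andP; split; lra.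
split.
- by move: phi_itv; rewrite in_itv.
- by move: theta_itv; rewrite in_itv.
rewrite -[spherical _ _](scalerK D0) cramer3 !scalerDr !scalerA.
by apply: cone_comb => //; rewrite mulrC.
Qed.

(** The domain over which [sphere_integral] integrates. *)
Definition angles (A : set R3) : set (R * R) :=
  [set u : R * R | [/\ 0 <= u.1 < 2 * pi, 0 <= u.2 <= pi
                     & A (spherical u.1 u.2)]].

Lemma angles_measurable (C : set R3) :
  closed C -> measurable (angles (sphere `&` C)).
Proof.
move=> clC.
rewrite (_ : angles _ = (`[0, 2 * pi[ `*` `[0, pi]) `&`
    (fun p => spherical p.1 p.2) @^-1` C); last first.
  apply/seteqP; split => [p|p] /=.
    by move=> [phi theta [_ Cp]]; rewrite !in_itv /= phi theta.
  rewrite !in_itv /= => -[[phi theta] Cp]; split => //.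
  by split => //; exact: enorm_spherical.
apply: measurableI; first by apply: measurableX; exact: measurable_itv.
rewrite -[X in measurable X]setCK; apply: measurableC.
apply: open_measurable_plane.
apply: (@open_comp _ _ (fun p => spherical p.1 p.2) (~` C)).
  by move=> p _; exact: spherical_continuous.
exact: closed_openC.
Qed.

Lemma angles_finite (A : set R3) : measurable (angles A) ->
  (lebesgue2 (angles A) < +oo)%E.
Proof.
move=> mA; apply: (@le_lt_trans _ _
  (lebesgue2 (`[0, 2 * pi]%classic `*` `[0, pi]%classic))).
  apply: le_measure; rewrite ?inE//.
    by apply: measurableX; exact: measurable_itv.
  move=> p [/andP[? /ltW ?] ? _]; rewrite /= !in_itv/=.
  by split=> //; apply/andP.
have fin (x y : R) : (lebesgue_measure (`[x, y]%classic : set R) < +oo)%E.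
  by rewrite lebesgue_measure_itv; case: ifP => _; rewrite -?EFinB ltry.
rewrite lebesgue2_itvX lte_mul_pinfty//.
by rewrite ge0_fin_numE.
Qed.

(** * The zonal harmonic and the magic angle *)

Lemma legendre2 (x : R) :
  (legendre R 2).[x] = (3 * x ^+ 2 - 1) / 2.
Proof.
rewrite /legendre hornerZ expr2 !derivnS derivn0.
rewrite -polyC1 !(derivM, derivB, derivD, derivXn, derivX, derivC, derivMn)/=.
rewrite !(hornerD, hornerM, hornerN, hornerXn, hornerX, hornerMn, hornerC)/=.
by rewrite (_ : 2`! = 2)%N// ?expr0 ?expr1; field.
Qed.

Lemma sph_harm20 : exists2 K : R, 0 < K & forall phi theta : R,
  sph_harm 2 0 phi theta = (K * (3 * cos theta ^+ 2 - 1))%:C%C.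
Proof.
set N := (Num.sqrt ((2 * 2%:R + 1) / (4 * pi)
     * ((absz (2%:Z - 0))`!%:R / (absz (2%:Z + 0))`!%:R)) : R).
have N0 : 0 < N.
  rewrite sqrtr_gt0 divff ?mulr1 ?pnatr_eq0//.
  by rewrite divr_gt0// ?mulr_gt0 ?pi_gt0//; lra.
exists (N / 2); first exact: divr_gt0.
move=> phi theta; rewrite /sph_harm -/N expr0z mul1r.
rewrite mul0r /expi cos0 sin0.
rewrite /assoc_legendre /assoc_legendre_nat /= !expr0 !mul1r legendre2.
rewrite -[(1 +i* 0)%C]/(1%:C)%C -!rmorphM mulr1; congr (_%:C)%C.
by field.
Qed.

Lemma std_cone_interior (g : R) :
  [set x : R3 | Num.sqrt (x.1.1 ^+ 2 + x.1.2 ^+ 2) < x.2 * tan g]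
    `<=` interior (std_cone g).
Proof.
rewrite -open_subsetE; first by move=> x /= /ltW.
pose f (x : R3) := x.2 * tan g - Num.sqrt (x.1.1 ^+ 2 + x.1.2 ^+ 2).
rewrite (_ : [set _ | _] = f @^-1` [set z | 0 < z]); last first.
  by apply/seteqP; split => x; rewrite /f /= subr_gt0.
apply: open_comp; last exact: open_gt.
move=> x _; apply: cvgB; first by apply: cvgM; [exact: cvg_snd|exact: cvg_cst].
apply: (@continuous_comp _ _ _ (fun y : R3 => y.1.1 ^+ 2 + y.1.2 ^+ 2)
  Num.sqrt).
  have c1 : {for x, continuous (fun y : R3 => y.1.1)}.
    by apply: (@continuous_comp _ _ _ fst fst); exact: cvg_fst.
  have c2 : {for x, continuous (fun y : R3 => y.1.2)}.
    by apply: (@continuous_comp _ _ _ fst snd); [exact: cvg_fst|exact: cvg_snd].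
  by apply: cvgD; apply: cvgM.
exact: sqrt_continuous.
Qed.

(** Outside the interior of the magic cone, [sin theta >= cos theta * tan t0]
    with [tan t0 ^+ 2 = 2]; membership in [std_cone g] makes [cos theta]
    nonnegative, so this can be squared to [1 - cos^2 >= 2 cos^2]. *)
Lemma magic_angle_cos (t0 g phi theta : R) :
  0 < t0 < pi / 2 -> cos t0 = 1 / Num.sqrt 3 -> 0 < g < pi / 2 ->
  0 <= theta <= pi ->
  (std_cone g `\` interior (std_cone t0)) (spherical phi theta) ->
  0 <= cos theta /\ 3 * cos theta ^+ 2 <= 1.
Proof.
move=> t0_itv cost0 g_itv theta_itv [].
have radius : Num.sqrt ((sin theta * cos phi) ^+ 2 + (sin theta * sin phi) ^+ 2)
    = sin theta.
  rewrite !exprMn -mulrDr cos2Dsin2 mulr1 sqrtr_sqr ger0_norm//.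
  exact: sin_ge0_pi.
have tan_gt0 (x : R) : 0 < x < pi / 2 -> 0 < tan x.
  move=> x_itv; rewrite divr_gt0// ?sin_gt0_pihalf// cos_gt0_pihalf//.
  by have := pi_gt0 R; lra.
have s0 := sin_ge0_pi theta_itv.
rewrite {1}/std_cone /= radius => sg not_int.
have c0 : 0 <= cos theta.
  by rewrite -(pmulr_lge0 _ (tan_gt0 g g_itv)) (le_trans s0).
split => //.
have : ~ (sin theta < cos theta * tan t0).
  by move=> h; apply/not_int/std_cone_interior; rewrite /= radius.
move/negP; rewrite -leNgt => st.
have tan2 : tan t0 ^+ 2 = 2.
  have cos2 : cos t0 ^+ 2 = 1 / 3.
    by rewrite cost0 expr_div_n sqr_sqrtr// expr1n.
  by rewrite /tan expr_div_n sin2cos2 cos2; field.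
have : (cos theta * tan t0) ^+ 2 <= sin theta ^+ 2.
  by rewrite lerXn2r ?nnegrE// mulr_ge0// ltW// tan_gt0.
by rewrite exprMn tan2 sin2cos2; lra.
Qed.

End Cones.

Theorem proposition3p7 (R : realType) (theta0 : R) (C : set (R * R * R))
  (theta0_itv : 0 < theta0 < pi / 2)
  (cos_theta0 : cos theta0 = 1 / Num.sqrt 3)
  (C_cone : closed_cone C)
  (C_convex : strictly_convex C)
  (C_nonnull : ~ lebesgue3.-negligible C)
  (C_exterior : connected (exterior C))
  (C_sub : exists gamma : R, theta0 < gamma < pi / 2 /\
    C `<=` std_cone gamma `\` interior (std_cone theta0)) :
  admissible_source_cone C.
Proof.
have [gamma [gamma_itv C_std]] := C_sub.
have {}gamma_itv : 0 < gamma < pi / 2 by lra.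
split => //.
  exists (0, 0, 1), gamma; split => //.
    by rewrite /enorm /dot /= !mulr0 !add0r mulr1 sqrtr1.
  by rewrite -std_coneE => x /C_std[].
exists 0; split => //.
have [K K0 Y20] := sph_harm20 R.
pose f (t : R) : R := K * (3 * cos t ^+ 2 - 1) * sin t.
pose D := angles (sphere `&` C).
have Re_Y20 (p : R * R) :
    complex.Re (sph_harm 2 0 p.1 p.2 * (sin p.2)%:C%C) = f p.2.
  by rewrite Y20 /= mulr0 subr0.
suff : Rintegral (lebesgue_measure \x lebesgue_measure)%E D (f \o snd) != 0.
  apply: contra => /eqP int0; apply/eqP.
  rewrite -[RHS]/(complex.Re (0 : R[i])) -int0.
  by apply: eq_Rintegral => p _; rewrite Re_Y20.
have band p : D p -> [/\ 0 <= p.2 <= pi, 0 <= cos p.2 & 3 * cos p.2 ^+ 2 <= 1].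
  move=> [_ p2 [_ Cp]].
  by have [] := magic_angle_cos theta0_itv cos_theta0 gamma_itv p2 (C_std _ Cp).
have mD : measurable D by apply: angles_measurable; case: C_cone.
have f_cont : continuous f.
  move=> t; apply: cvgM; last exact: continuous_sin.
  apply: cvgM; first exact: cvg_cst.
  apply: cvgB; last exact: cvg_cst.
  apply: cvgM; first exact: cvg_cst.
  by apply: cvgM; exact: continuous_cos.
have f_bound t : `|f t| <= K * 2.
  rewrite !normrM (gtr0_norm K0) -mulrA ler_pM2l// -[leRHS]mulr1.
  apply: ler_pM => //; last exact: sin_max.
  have := sin2cos2 t; have := sqr_ge0 (cos t); have := sqr_ge0 (sin t).
  by rewrite ler_norml => ? ? ?; apply/andP; split; lra.
have [a [b [c [d [ab cd box]]]]] := convex_cone_box C_cone C_convex.1 C_nonnull.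
have boxD p : (`]a, b[ `*` `]c, d[) p -> D p.
  rewrite /= !in_itv /= => -[/box in_box /in_box].
  move=> [/andP[/ltW ? ?] /andP[/ltW ? /ltW ?] Cp].
  split; [exact/andP|exact/andP|split => //; exact: enorm_spherical].
apply: (@Rintegral_le0_neq0 _ _ R (lebesgue_measure \x lebesgue_measure)%E
  D (`]a, b[ `*` `]c, d[)) => //.
- apply: zonal_integrable => //; first by exists (K * 2).
  exact: angles_finite.
- move=> p /band[/sin_ge0_pi s0 _ c2].
  by rewrite /f /= mulr_le0_ge0// mulr_ge0_le0 ?subr_le0// ltW.
- move=> p pbox; have pD := boxD p pbox; split => //.
  move: pbox; rewrite /= !in_itv /= => -[ap /andP[cp pd]].
  have [p_itv p0 _] := band p pD.
  (* Comparing with a smaller angle of the rectangle makes the bound strict. *)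
  pose m := (c + p.2) / 2.
  have [//|m1 m2 Cm] := boxD (p.1, m).
    by rewrite /= !in_itv /= ap /m; split => //; apply/andP; split; lra.
  have [/= m_itv m0 cm] := band (p.1, m) (And3 m1 m2 Cm).
  have mp : m < p.2 by rewrite /m; lra.
  have cpm : cos p.2 < cos m by rewrite ltr_cos// in_itv.
  have [_ /andP[p20 p2pi] _] := box _ _ ap (introT andP (conj cp pd)).
  rewrite /f /= pmulr_llt0; last by apply: sin_gt0_pi; rewrite p20.
  rewrite pmulr_rlt0// subr_lt0 (lt_le_trans _ cm)// ltr_pM2l//.
  by rewrite ltrXn2r.
- exact: box_nonnull.
Qed.
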